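(* Let $\mathfrak{E},\mathfrak{H},\mathfrak{K}$ be Hilbert spaces, let $A\in\mathbf{B}(\mathfrak{E},\mathfrak{H})$ and $B\in\mathbf{B}(\mathfrak{E},\mathfrak{K})$, and let $L(A,B)=\{\{Af,Bf\}:f\in\mathfrak{E}\}$. Then the following statements are equivalent: (i) $B$ is singular with respect to $A$; (ii) $\operatorname{ran}A^*\cap\operatorname{ran}B^*=\{0\}$; (iii) $L(A,B)$ is singular.
   Context: $\mathbf{B}(\mathfrak{X},\mathfrak{Y})$ denotes the everywhere defined bounded linear operators from the Hilbert space $\mathfrak{X}$ to the Hilbert space $\mathfrak{Y}$; $\mathbf{B}(\mathfrak{X})=\mathbf{B}(\mathfrak{X},\mathfrak{X})$. A linear relation from $\mathfrak{H}$ to $\mathfrak{K}$ is a linear subspace of $\mathfrak{H}\times\mathfrak{K}$, with elements written $\{f,g\}$. A linear relation is singular if its closure in $\mathfrak{H}\times\mathfrak{K}$ is the product of a closed linear subspace of $\mathfrak{H}$ and a closed linear subspace of $\mathfrak{K}$. For bounded operators $D$ and $A$ on $\mathfrak{E}$ (with values in possibly different Hilbert spaces), $D\prec A$ means there is $c>0$ with $\|Df\|\le c\|Af\|$ for all $f\in\mathfrak{E}$. The operator $B$ is singular with respect to $A$ if for every $D\in\mathbf{B}(\mathfrak{E})$: $D\prec A$ and $D\prec B$ imply $D=0$. *)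

(* Defs.v *)
From HB Require Import structures.
From mathcomp Require Import all_boot all_order all_algebra sesquilinear.
From mathcomp Require Import complex.
From mathcomp Require Import boolp classical_sets reals topology normedtype.

Set Implicit Arguments.
Unset Strict Implicit.
Unset Printing Implicit Defensive.

Import Order.TTheory GRing.Theory Num.Theory.
Import numFieldNormedType.Exports.

Local Open Scope classical_set_scope.
Local Open Scope ring_scope.

(* The inner product is linear in its first argument and conjugate-linear in
   its second one. *)
HB.mixin Record NormedModule_isHilbert (K : numClosedFieldType) T
    of CompleteNormedModule K T := {
  inner : {dot T for @Num.conj K} ;
  inner_sqr_norm : forall x : T, inner x x = `|x| ^+ 2
}.

(* Genuine complex Hilbert spaces are obtained for K := R[i], R : realType. *)
#[short(type="hilbertType")]
HB.structure Definition Hilbert (K : numClosedFieldType) :=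
  {T of CompleteNormedModule K T & NormedModule_isHilbert K T}.

Section Definitions.
Variable K : numClosedFieldType.

(* For linear f this is: `|f x| <= r * `|x| for all x and some r, see
   linear_boundedP. *)
Definition bounded_operator (X Y : hilbertType K) (f : X -> Y) : Prop :=
  bounded_near f (nbhs (0 : X)).

(* For f linear and bounded, the Riesz representation theorem provides exactly
   one x satisfying the condition; get selects it. *)
Definition adjoint (X Y : hilbertType K) (f : X -> Y) (y : Y) : X :=
  get [set x : X | forall u : X, inner (f u) y = inner u x].

Definition linear_subspace (V : lmodType K) (S : set V) : Prop :=
  S 0 /\ forall (a : K) (u v : V), S u -> S v -> S (a *: u + v).

(* The order of K only compares numbers with the same imaginary part, so
   0 < c forces c to be real. *)
Definition dominated (E X Y : hilbertType K) (D : E -> X) (A : E -> Y) : Prop :=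
  exists2 c : K, 0 < c & forall f : E, `|D f| <= c * `|A f|.

Definition singular_wrt (E X Y : hilbertType K) (B : E -> Y) (A : E -> X)
    : Prop :=
  forall D : {linear E -> E}, bounded_operator D ->
    dominated D A -> dominated D B -> forall f : E, D f = 0.

Definition singular_relation (X Y : hilbertType K) (L : set (X * Y)) : Prop :=
  exists (M : set X) (N : set Y),
    [/\ linear_subspace M, closed M, linear_subspace N, closed N
      & closure L = M `*` N].

Definition pair_relation (E X Y : hilbertType K) (A : E -> X) (B : E -> Y)
    : set (X * Y) :=
  [set (A f, B f) | f in [set: E]].

Lemma pair_relation_linear (E X Y : hilbertType K) (A : {linear E -> X})
    (B : {linear E -> Y}) : linear_subspace (pair_relation A B).
Proof.
split; first by exists 0; rewrite ?linear0.
move=> a _ _ [f _ <-] [g _ <-]; exists (a *: f + g) => //.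
by rewrite !linearP.
Qed.

End Definitions.

(* Main.v *)
Require Import Defs.
From HB Require Import structures.
From mathcomp Require Import all_boot all_order all_algebra sesquilinear.
From mathcomp Require Import complex.
From mathcomp Require Import boolp classical_sets reals topology normedtype.
From mathcomp Require Import ring.

Set Implicit Arguments.
Unset Strict Implicit.
Unset Printing Implicit Defensive.

Import Order.TTheory GRing.Theory Num.Theory.
Import numFieldNormedType.Exports.

Local Open Scope classical_set_scope.
Local Open Scope ring_scope.

(** Everything rests on one form of the Riesz representation theorem,
    [riesz_pair]: a linear functional phi on E that is bounded by a multiple of
    |A u| + |B u| is given by pairing with a point (h, k) of the closure of
    L(A, B), namely phi u = <A u, h> + <B u, k>.  The point is obtained by
    minimizing the energy |A u|^2 + |B u|^2 - 2 Re (phi u) over E: the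
    parallelogram identity makes the images under A and B of the low sublevel
    sets Cauchy, and the stationarity of the energy at the limit is the desired
    equation.  Minimizing over E, rather than over a closed subspace, avoids
    putting a Hilbert norm on the product H x K.

    With the identity for A and 0 for B the theorem yields the adjoint; with
    B = 0 it yields Douglas' range inclusion (a functional dominated by |A u| is
    represented through A), and with both operators it replaces the orthogonal
    decomposition of H x K with respect to L(A, B).

    (i) => (ii).  If x = A^* h = B^* k, the rank-one operator u |-> <u, x> x is
    dominated by A and by B, hence vanishes, so x = 0.

    (ii) => (i).  If D is dominated by A and by B, then D^* y lies in ran A^* and
    in ran B^* for every y, so D^* = 0 and D = 0.

    (iii) => (ii).  If A^* h = B^* k, the set of (f, g) with <f, h> = <g, k> is
    closed and contains L(A, B).  When the closure is a product M x N it contains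
    (A u, 0), hence <A u, h> = 0 for all u.

    (ii) => (iii).  The closure is the product of the double orthocomplements M
    and N of ran A and ran B.  Indeed for (a, b) in M x N the functional
    u |-> <A u, a> + <B u, b> is represented by some (h, k) in the closure, so
    A^* (a - h) = B^* (k - b) lies in both ranges and vanishes; thus a - h is
    orthogonal to ran A while belonging to M, and (a, b) = (h, k). *)

(** * Inner products *)

Section InnerProduct.
Variables (F : numClosedFieldType) (X : hilbertType F).
Implicit Types (x y z : X) (a : F).

Lemma innerC x y : inner x y = (inner y x)^*.
Proof. by rewrite hermC expr0 mul1r. Qed.

Lemma innerZl a x y : inner (a *: x) y = a * inner x y.
Proof. exact: linearZl_LR. Qed.

Lemma innerZr a x y : inner x (a *: y) = a^* * inner x y.
Proof. exact: linearZr_LR. Qed.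

Lemma innerBr x y z : inner x (y - z) = inner x y - inner x z.
Proof. exact: linearBr. Qed.

Lemma inner_eq0C x y : inner x y = 0 -> inner y x = 0.
Proof. by move=> xy0; rewrite innerC xy0 conjC0. Qed.

Lemma inner_self_eq0 x : inner x x = 0 -> x = 0.
Proof. by rewrite inner_sqr_norm => /eqP; rewrite sqrf_eq0 normr_eq0 => /eqP. Qed.

(** The projection of [x] onto the line of [y] leaves a nonnegative rest. *)
Lemma cauchy_schwarz x y : `|inner x y| <= `|x| * `|y|.
Proof.
have [->|y0] := eqVneq y 0; first by rewrite linear0r !normr0 mulr0.
have Y0 : 0 < `|y| ^+ 2 by rewrite exprn_gt0 // normr_gt0.
rewrite -(@ler_pXn2r _ 2) ?nnegrE ?mulr_ge0 // exprMn -ler_pdivrMr //.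
have := exprn_ge0 2 (normr_ge0 (x - (inner x y / `|y| ^+ 2) *: y)).
rewrite -inner_sqr_norm dnormB dnormZ innerZr !inner_sqr_norm.
set p := inner x y; set q := `|y| ^+ 2 in Y0 *.
have qq : q^* = q by rewrite geC0_conj // ltW.
clearbody p q; rewrite normf_div (gtr0_norm Y0) !(rmorphM, fmorphV) /= !(qq, conjCK).
rewrite -[_ <= `|x| ^+ 2]subr_ge0 exprMn normCK => le0.
apply: le_trans le0 _; rewrite le_eqVlt; apply/orP; left.
apply/eqP; field; exact: lt0r_neq0.
Qed.

Lemma inner_continuousl y : continuous (inner^~ y).
Proof.
move=> x; apply/cvgrPdist_lt => e e0.
have y1 : 0 < `|y| + 1 by rewrite ltr_wpDl.
have /cvgrPdist_lt/(_ (e / (`|y| + 1)) (divr_gt0 e0 y1)) := @cvg_id _ (nbhs x).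
apply: filterS => z; rewrite ltr_pdivlMr // => xz.
rewrite -linearBl; apply: le_lt_trans (cauchy_schwarz _ _) _.
by apply: le_lt_trans xz; rewrite ler_wpM2l // lerDl.
Qed.

Lemma inner_continuousr x : continuous (inner x).
Proof.
move=> y; apply/cvgrPdist_lt => e e0.
have /cvgrPdist_lt/(_ e e0) := @inner_continuousl x y.
apply: filterS => z; rewrite innerC [inner z x]innerC -rmorphB.
by rewrite norm_conjC.
Qed.

End InnerProduct.

(** * Minimizing filters *)

Section Minimization.
Variables (R : realType) (T : Type) (J : T -> R[i]).

(** The order of [R[i]] is partial, so the infimum is taken among the real parts
    and embedded back; afterwards no real part is needed. *)
Lemma real_valued_inf (x0 : T) (b : R[i]) :
  (forall x, J x \is Num.real) -> (forall x, b <= J x) ->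
  exists m, (forall x, m <= J x) /\ forall e, 0 < e -> exists x, J x < m + e.
Proof.
move=> Jr Jb; have JE x := RRe_real (Jr x).
have bE : (complex.Re b)%:C%C = b.
  by apply: RRe_real; rewrite (ler_real (Jb x0)) Jr.
pose S := range (fun x => complex.Re (J x)).
have Slb : lbound S (complex.Re b).
  by move=> _ [x _ <-]; rewrite -lecR JE bE.
have hinf : has_inf S by split; [exists (complex.Re (J x0)), x0|eexists; exact: Slb].
exists (inf S)%:C%C; split=> [x|e e0].
  by rewrite -JE lecR ge_inf //; [case: hinf|exists x].
have eE := RRe_real (gtr0_real e0).
have e0' : 0 < complex.Re e by rewrite -ltcR eE.
have [_ [x _ <-] xlt] := inf_adherent e0' hinf.
by exists x; rewrite -JE -eE -raddfD ltcR.
Qed.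

(** When [m] is the infimum of [J], convergence along this filter is convergence
    of minimizing sequences, without having to choose one. *)
Definition sublevels (m : R[i]) : set_system T :=
  [set P | exists2 e, 0 < e & forall x, J x < m + e -> P x].

Lemma sublevels_proper (m : R[i]) :
  (forall e, 0 < e -> exists x, J x < m + e) -> ProperFilter (sublevels m).
Proof.
move=> Jm; apply: Build_ProperFilter_ex => [P [e e0 Pe]|].
  by have [x /Pe] := Jm e e0; exists x.
split=> [|P Q [e e0 Pe] [d d0 Qd]|P Q PQ [e e0 Pe]].
- by exists 1.
- have ed : (e >=< d)%O by rewrite real_comparable ?gtr0_real.
  exists (Order.min e d) => [|x]; first by rewrite comparable_lt_min // e0.
  by rewrite -ltrBlDl comparable_lt_min // !ltrBlDl => /andP[/Pe ? /Qd].
- by exists e => // x /Pe/PQ.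
Qed.

End Minimization.

(** * Riesz representation along a pair of operators *)

Section RieszPair.
Variables (R : realType) (E H K : hilbertType R[i]).
Variables (A : {linear E -> H}) (B : {linear E -> K}) (phi : E -> R[i]).

Hypothesis phi_linear : GRing.linear_for *%R phi.

Let phi0 : phi 0 = 0.
Proof. by have := phi_linear (-1) 0 0; rewrite scaler0 addr0 mulN1r addNr. Qed.

Let phiD u v : phi (u + v) = phi u + phi v.
Proof. by rewrite -[u]scale1r phi_linear mul1r scale1r. Qed.

Let phiZ a u : phi (a *: u) = a * phi u.
Proof. by rewrite -[a *: u]addr0 phi_linear phi0 addr0. Qed.

Let N u : R[i] := `|A u| ^+ 2 + `|B u| ^+ 2.

Let N_ge0 u : 0 <= N u.
Proof. by rewrite addr_ge0 ?exprn_ge0. Qed.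

Let NZ a u : N (a *: u) = `|a| ^+ 2 * N u.
Proof. by rewrite /N !linearZ /= !normrZ !exprMn mulrDr. Qed.

(** Up to a constant, the squared distance in H x K of [(A u, B u)] to the vector
    that represents [phi]. *)
Definition energy u : R[i] := N u - (phi u + (phi u)^*).

(** The real part of [slope u v] is half the derivative of the energy at [u] in
    the direction [v]; it vanishes for all [v] at a minimum. *)
Let slope u v := inner (A v) (A u) + inner (B v) (B u) - phi v.

Let slopeZ a u v : slope u (a *: v) = a * slope u v.
Proof. by rewrite /slope !linearZ /= !innerZl phiZ; ring. Qed.

Let energyD u v : energy (u + v) = energy u + N v + (slope u v + (slope u v)^*).
Proof.
rewrite /energy /N /slope !linearD /= phiD -!inner_sqr_norm !dnormD !rmorphD !rmorphN /=.
rewrite -!innerC; ring.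
Qed.

Let energy_real u : energy u \is Num.real.
Proof.
rewrite rpredB ?(ger0_real (N_ge0 u)) //.
have -> : phi u + (phi u)^* = 2 * 'Re (phi u) by rewrite ReE; field.
by rewrite realM ?realn ?Creal_Re.
Qed.

Let energy_parallelogram u v :
  energy (u + v) + energy (u - v) = 2 * energy u + 2 * N v.
Proof.
rewrite !energyD -scaleN1r NZ slopeZ rmorphM /= normrN1 rmorphN1; ring.
Qed.

(** The energy is bounded below because of the domination hypothesis.  The
    parallelogram identity makes [A] and [B] converge along the filter of its
    sublevel sets, although [u] itself need not converge in E.  Along that filter
    the slopes tend to 0, which in the limit is the claimed representation. *)
Lemma riesz_pair (c : R[i]) : 0 <= c ->
  (forall u, `|phi u| <= c * (`|A u| + `|B u|)) ->
  exists p, closure (pair_relation A B) p /\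
    forall u, phi u = inner (A u) p.1 + inner (B u) p.2.
Proof.
move=> c0 phic.
(* complete the squares (|A u| - c)^2 and (|B u| - c)^2 *)
have energy_lb u : - (2 * c ^+ 2) <= energy u.
  have le1 : phi u + (phi u)^* <= 2 * (c * (`|A u| + `|B u|)).
    apply: le_trans (_ : 2 * `|phi u| <= _); last by rewrite ler_pM2l.
    have -> : phi u + (phi u)^* = 2 * 'Re (phi u) by rewrite ReE; field.
    by rewrite ler_pM2l // (leif_Re_Creal _).1.
  rewrite /energy /N -subr_ge0.
  have sq x : 0 <= x -> 0 <= (x - c) ^+ 2.
    by move=> x0; rewrite real_exprn_even_ge0 // rpredB // ger0_real.
  rewrite -subr_ge0 in le1.
  have := addr_ge0 (addr_ge0 (sq _ (normr_ge0 (A u))) (sq _ (normr_ge0 (B u)))) le1.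
  by congr (0 <= _); ring.
have [m [mle madh]] := real_valued_inf 0 energy_real energy_lb.
pose F := sublevels energy m.
have FF : ProperFilter F by exact: sublevels_proper.
(* The midpoint p of u and v has energy at least m, so the parallelogram
   identity around p bounds N of the half-difference w by e^2 / 4. *)
have Nsmall e u v : 0 < e -> energy u < m + e ^+ 2 / 4 ->
    energy v < m + e ^+ 2 / 4 -> N (u - v) < e ^+ 2.
  move=> e0 ue ve.
  pose p := 2^-1 *: (u + v); pose w := 2^-1 *: (u - v).
  have half x : x = 2^-1 *: (x + x) :> E.
    by rewrite -mulr2n -[x *+ 2]scaler_nat scalerA mulVf ?pnatr_eq0 // scale1r.
  have uE : u = p + w by rewrite -scalerDr addrCA addrAC subrK -half.
  have vE : v = p - w.
    by rewrite -scalerBr opprB addrC addrA subrK -half.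
  have lt2m : 2 * energy p + 2 * (2^-1 ^+ 2 * N (u - v)) <
      m + e ^+ 2 / 4 + (m + e ^+ 2 / 4).
    have := ltrD ue ve; rewrite {1}uE {1}vE energy_parallelogram NZ.
    by rewrite normfV normr_nat.
  have lb : 2 * m + 2 * (2^-1 ^+ 2 * N (u - v)) <=
      2 * energy p + 2 * (2^-1 ^+ 2 * N (u - v)).
    by rewrite lerD2r ler_pM2l.
  rewrite -(ltr_pM2l (_ : 0 < 2^-1)) ?invr_gt0 // -(ltrD2l (2 * m)).
  have := le_lt_trans lb lt2m.
  by congr (_ < _); field.
have cvgF (X : hilbertType R[i]) (C : {linear E -> X}) :
    (forall u, `|C u| ^+ 2 <= N u) -> cvg (C @ F).
  move=> CN; apply: cauchy_cvg; apply: cauchy_exP => e e0.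
  have e2 : 0 < e ^+ 2 / 4 by rewrite divr_gt0 ?exprn_gt0.
  have [u ue] := madh _ e2.
  exists (C u), (e ^+ 2 / 4) => // v ve.
  rewrite /= -ball_normE /= -linearB -(@ltr_pXn2r _ 2) ?nnegrE // ?(ltW e0) //.
  exact: le_lt_trans (CN _) (Nsmall _ _ _ e0 ue ve).
have Ah : A @ F --> lim (A @ F) by apply: cvgF => u; rewrite lerDl exprn_ge0.
have Bk : B @ F --> lim (B @ F) by apply: cvgF => u; rewrite lerDr exprn_ge0.
set h := lim (A @ F) in Ah; set k := lim (B @ F) in Bk.
exists (h, k); split=> [U /(cvg_pair Ah Bk) FU|v /=].
  have /filter_ex[u Uu] : F [set u | U (A u, B u)] by exact: FU.
  by exists (A u, B u); split=> //; exists u.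
have n0 : 0 < N v + 1 by rewrite ltr_wpDl.
(* The step a *: v, directed against the slope and scaled by 1 / (N v + 1),
   decreases the energy by at least |slope|^2 / (N v + 1), which is less than e.
   The added 1 covers the case N v = 0. *)
have slope_small e u : 0 < e -> energy u < m + e -> `|slope u v| ^+ 2 < e * (N v + 1).
  move=> e0 ue; pose a := - ((N v + 1)^-1 * (slope u v)^*).
  have aE : energy (u + a *: v) + `|slope u v| ^+ 2 / (N v + 1) ^+ 2 =
            energy u - `|slope u v| ^+ 2 / (N v + 1).
    rewrite energyD NZ slopeZ /a normrN normrM norm_conjC normfV (gtr0_norm n0).
    rewrite !(rmorphM, rmorphN, fmorphV) /= conjCK (geC0_conj (ltW n0)).
    rewrite exprMn normCK; field; exact: lt0r_neq0.
  have : m <= energy u - `|slope u v| ^+ 2 / (N v + 1).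
    rewrite -aE; apply: le_trans (mle (u + a *: v)) _.
    by rewrite lerDl divr_ge0 ?exprn_ge0 // ltW.
  rewrite lerBrDr => /le_lt_trans /(_ ue).
  by rewrite ltrD2l ltr_pdivrMr.
(* the topology of scalars is found on a [numFieldType], not on [R[i]] itself *)
pose C : numFieldType := R[i]; pose slope_v u : C := slope u v.
have slope0 : slope_v @ F --> (0 : C).
  apply/cvgrPdist_lt => e e0; exists (e ^+ 2 / (N v + 1)) => [|u ue].
    by rewrite divr_gt0 ?exprn_gt0.
  rewrite sub0r normrN -(@ltr_pXn2r _ 2) ?nnegrE // ?(ltW e0) //.
  have := slope_small _ _ _ ue; rewrite divfK ?lt0r_neq0 //; apply.
  by rewrite divr_gt0 ?exprn_gt0.
have slope_lim : slope_v @ F --> (inner (A v) h + inner (B v) k - phi v : C).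
  apply: cvgB; last exact: cvg_cst.
  apply: cvgD; first exact: (cvg_comp _ _ Ah (@inner_continuousr _ _ (A v) h)).
  exact: (cvg_comp _ _ Bk (@inner_continuousr _ _ (B v) k)).
apply/esym/eqP; rewrite -subr_eq0; apply/eqP.
exact: (cvg_unique (@norm_hausdorff _ C) slope_lim slope0).
Qed.

End RieszPair.

(** * Adjoints and their ranges *)

Section RangeOfAdjoint.
Variable R : realType.
Implicit Types E H : hilbertType R[i].

(** Douglas' range inclusion in terms of functionals: taking
    [phi u = <D u, y>], domination of [D] by [A] puts D^* y into ran A^*. *)
Lemma riesz_dominated E H (A : {linear E -> H}) (phi : E -> R[i]) (c : R[i]) :
    GRing.linear_for *%R phi -> 0 <= c -> (forall u, `|phi u| <= c * `|A u|) ->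
  exists h, forall u, phi u = inner (A u) h.
Proof.
move=> phi_linear c0 phic.
have [|[h k] [_ /= phiE]] := @riesz_pair _ _ _ H A \0 _ phi_linear _ c0.
  by move=> u; rewrite normr0 addr0.
by exists h => u; rewrite phiE linear0l addr0.
Qed.

Lemma inner_linearl E H (A : {linear E -> H}) y :
  GRing.linear_for *%R (fun u => inner (A u) y).
Proof. by move=> a u v; rewrite linearP linearPl. Qed.

Lemma bounded_operatorP E H (A : {linear E -> H}) :
  bounded_operator A <-> dominated A (@idfun E).
Proof.
split=> [/linear_boundedP/pinfty_ex_gt0[c c0 Ac]|[c c0 Ac]]; first by exists c.
apply/linear_boundedP; near=> d => u; apply: le_trans (Ac u) _.
rewrite ler_wpM2r //; near: d; exact/nbhs_pinfty_ge/gtr0_real.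
Unshelve. all: by end_near. Qed.

Variables (E H : hilbertType R[i]) (A : {linear E -> H}) (bndA : bounded_operator A).

(** The defining choice of [adjoint] succeeds: Riesz representation of
    [u |-> <A u, y>] with respect to the identity of E. *)
Lemma adjointE y u : inner (A u) y = inner u (adjoint A y).
Proof.
have [c c0 Ac] := (bounded_operatorP A).1 bndA.
suff [x xE] : exists x, forall u, inner (A u) y = inner u x.
  exact: (@getI _ [set x | forall u, inner (A u) y = inner u x] x xE).
apply: (@riesz_dominated E E idfun (fun v => inner (A v) y) (c * `|y|)) => [||v].
- exact: inner_linearl.
- by rewrite mulr_ge0 // ltW.
- apply: le_trans (cauchy_schwarz _ _) _.
  by rewrite mulrAC ler_wpM2r.
Qed.

Lemma range_adjointP x :
  range (adjoint A) x <-> exists y, forall u, inner (A u) y = inner u x.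
Proof.
split=> [[y _ <-]|[y yx]]; first by exists y => u; exact: adjointE.
exists y => //; apply/eqP; rewrite -subr_eq0; apply/eqP/inner_self_eq0.
by rewrite innerBr -adjointE yx subrr.
Qed.

Lemma range_adjoint0 : range (adjoint A) 0.
Proof. by apply/range_adjointP; exists 0 => u; rewrite !linear0r. Qed.

End RangeOfAdjoint.

(** * Orthocomplements *)

Lemma closed_zeros (F : numFieldType) (T : topologicalType) (f : T -> F) :
  continuous f -> closed [set t | f t = 0].
Proof.
move=> /continuous_closedP fcl; apply: (fcl [set 0]).
exact/accessible_closed_set1/hausdorff_accessible/norm_hausdorff.
Qed.

Section Orthocomplement.
Variables (F : numClosedFieldType) (X : hilbertType F).

Definition orthocomplement (S : set X) : set X :=
  [set h | forall s, S s -> inner s h = 0].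

Lemma orthocomplement_subspace (S : set X) :
  linear_subspace (orthocomplement S).
Proof.
split=> [s _|a u v Su Sv s Ss]; first exact: linear0r.
by rewrite linearPr /= Su // Sv // mulr0 addr0.
Qed.

Lemma orthocomplement_closed (S : set X) : closed (orthocomplement S).
Proof.
rewrite (_ : orthocomplement S = \bigcap_(s in S) [set h | inner s h = 0]) //.
apply: closed_bigI => s _; exact/closed_zeros/inner_continuousr.
Qed.

Lemma sub_orthocomplement2 (S : set X) :
  S `<=` orthocomplement (orthocomplement S).
Proof. by move=> s Ss h Sh; apply/inner_eq0C/Sh. Qed.

(** The difference lies in [S]^perp and in [S]^perp^perp, hence is orthogonal to
    itself. *)
Lemma orthocomplement2_inj (S : set X) x y :
    orthocomplement (orthocomplement S) x ->
    orthocomplement (orthocomplement S) y ->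
  orthocomplement S (x - y) -> x = y.
Proof.
move=> Sx Sy Sxy; apply/eqP; rewrite -subr_eq0; apply/eqP/inner_self_eq0.
by rewrite innerBr Sx // Sy // subrr.
Qed.

End Orthocomplement.

(** * Rank-one operators *)

Section RankOne.
Variables (F : numClosedFieldType) (X : hilbertType F).

Definition rank_one (x u : X) : X := inner u x *: x.

Lemma rank_one_linear x : linear (rank_one x).
Proof. by move=> a u v; rewrite /rank_one linearPl scalerDl scalerA. Qed.

HB.instance Definition _ x :=
  GRing.isLinear.Build F X X _ (rank_one x) (rank_one_linear x).

Lemma norm_rank_one x u : `|rank_one x u| = `|inner u x| * `|x|.
Proof. exact: normrZ. Qed.

(** If [x] is A^* y, then |<u, x>| = |<A u, y>| is at most |A u| |y|. *)
Lemma dominated_rank_one (Y : hilbertType F) (A : X -> Y) x y :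
  (forall u, inner (A u) y = inner u x) -> dominated (rank_one x) A.
Proof.
move=> yx.
(* the added 1 keeps the constant positive when x or y is 0 *)
exists (`|y| * `|x| + 1) => [|u].
  by rewrite ltr_wpDl ?mulr_ge0.
rewrite norm_rank_one -yx mulrDl mul1r ler_wpDr //.
by rewrite mulrAC ler_wpM2r // mulrC cauchy_schwarz.
Qed.

End RankOne.

(** * The equivalences *)

Section Equivalences.
Variables (R : realType) (E H K : hilbertType R[i]).
Variables (A : {linear E -> H}) (B : {linear E -> K}).
Hypotheses (bndA : bounded_operator A) (bndB : bounded_operator B).

Let ran_disjoint := range (adjoint A) `&` range (adjoint B) = [set (0 : E)].

(** Condition (ii) without adjoints: [A^* h = B^* k] only if both are 0. *)
Lemma ran_disjointP : ran_disjoint <->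
  forall h k, (forall u, inner (A u) h = inner (B u) k) ->
    forall u, inner (A u) h = 0.
Proof.
split=> [AB0 h k hk u|AB0].
  suff x0 : adjoint A h = 0 by rewrite adjointE // x0 linear0r.
  suff : (range (adjoint A) `&` range (adjoint B)) (adjoint A h) by rewrite AB0.
  split; first by exists h.
  by apply/range_adjointP => //; exists k => v; rewrite -hk adjointE.
apply/seteqP; split=> [x [xA xB]|_ ->]; last by split; exact: range_adjoint0.
have [h hx] := (range_adjointP bndA x).1 xA.
have [k kx] := (range_adjointP bndB x).1 xB.
apply: inner_self_eq0; rewrite -hx.
by apply: (AB0 h k) => u; rewrite hx kx.
Qed.

(** A common vector [x] of the two ranges gives a rank-one operator dominated by
    both [A] and [B]; conversely, for a dominated [D] the functionals
    [u |-> <D u, D f>] are represented through [A] and through [B]. *)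
Lemma singular_wrt_ran_disjoint : singular_wrt B A <-> ran_disjoint.
Proof.
split=> [sing|/ran_disjointP AB0 D bndD [c c0 DA] [d d0 DB] f].
  apply/seteqP; split=> [x [xA xB]|_ ->]; last by split; exact: range_adjoint0.
  have [h hx] := (range_adjointP bndA x).1 xA.
  have [k kx] := (range_adjointP bndB x).1 xB.
  have bnd1 : bounded_operator (rank_one x).
    by apply/bounded_operatorP/(@dominated_rank_one _ _ _ idfun x x).
  have := sing (rank_one x) bnd1 (dominated_rank_one hx) (dominated_rank_one kx) x.
  rewrite /rank_one => /eqP; rewrite scaler_eq0 => /orP[/eqP/inner_self_eq0|/eqP] //.
have phi_linear := inner_linearl D (D f).
have phi_le (X : hilbertType R[i]) (C : E -> X) b : 0 < b ->
    (forall u, `|D u| <= b * `|C u|) ->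
    forall u, `|inner (D u) (D f)| <= b * `|D f| * `|C u|.
  move=> b0 DC u; apply: le_trans (cauchy_schwarz _ _) _.
  by rewrite mulrAC ler_wpM2r.
have [|h hE] := riesz_dominated phi_linear _ (phi_le _ _ _ c0 DA).
  by rewrite mulr_ge0 // ltW.
have [|k kE] := riesz_dominated phi_linear _ (phi_le _ _ _ d0 DB).
  by rewrite mulr_ge0 // ltW.
apply: inner_self_eq0; rewrite hE.
by apply: (AB0 h k) => u; rewrite -hE -kE.
Qed.

(** A continuous functional [f] that vanishes on L(A, B) vanishes on its closure,
    which contains (A u, 0) as soon as it is a product. *)
Lemma singular_relation_ran_disjoint :
  singular_relation (pair_relation A B) -> ran_disjoint.
Proof.
move=> [M [N [[M0 _] _ [N0 _] _ clE]]]; apply/ran_disjointP => h k hk u.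
pose C : numFieldType := R[i].
pose f (p : H * K) : C := inner p.1 h - inner p.2 k.
have f_cont : continuous f.
  move=> p; apply: cvgB.
    exact: (cvg_comp _ _ (@cvg_fst _ _ (nbhs p.1) (nbhs p.2) _)
                     (@inner_continuousl _ _ h p.1)).
  exact: (cvg_comp _ _ (@cvg_snd _ _ (nbhs p.1) (nbhs p.2) _)
                   (@inner_continuousl _ _ k p.2)).
have cl_f p : closure (pair_relation A B) p -> f p = 0.
  move=> /(closureS (B := [set p | f p = 0])) clp; apply: (closed_zeros f_cont).
  by apply: clp => _ [v _ <-]; rewrite /f /= hk subrr.
have : (M `*` N) (A u, B u).
  by rewrite -clE; apply: subset_closure; exists u.
move=> [/= MA _]; have : closure (pair_relation A B) (A u, 0) by rewrite clE.
by move=> /cl_f; rewrite /f /= linear0l subr0.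
Qed.

(** The double orthocomplements of the ranges are used as the factors of the
    product since they are visibly closed subspaces, and membership in them is
    tested by inner products. *)
Lemma ran_disjoint_singular_relation :
  ran_disjoint -> singular_relation (pair_relation A B).
Proof.
move=> /ran_disjointP AB0.
pose M := orthocomplement (orthocomplement (range A)).
pose N := orthocomplement (orthocomplement (range B)).
have Mcl : closed M by exact: orthocomplement_closed.
have Ncl : closed N by exact: orthocomplement_closed.
exists M, N; split; [exact: orthocomplement_subspace|exact: Mcl|
  exact: orthocomplement_subspace|exact: Ncl|].
have clMN : closure (pair_relation A B) `<=` M `*` N.
  rewrite [X in _ `<=` X](closure_id _).1; last first.
    have fst_cont : continuous (@fst H K).
      by move=> p; exact: (@cvg_fst _ _ (nbhs p.1) (nbhs p.2)).
    have snd_cont : continuous (@snd H K).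
      by move=> p; exact: (@cvg_snd _ _ (nbhs p.1) (nbhs p.2)).
    apply: closedI; first exact: ((continuous_closedP _).1 fst_cont).
    exact: ((continuous_closedP _).1 snd_cont).
  apply: closureS => _ [u _ <-].
  by split; apply: sub_orthocomplement2; exists u.
apply/seteqP; split=> // -[a b] [/= Ma Nb].
pose phi u := inner (A u) a + inner (B u) b.
have phi_linear : GRing.linear_for *%R phi.
  by move=> t u v; rewrite /phi !inner_linearl mulrDr addrACA.
have phi_le u : `|phi u| <= (`|a| + `|b|) * (`|A u| + `|B u|).
  apply: le_trans (ler_normD _ _) _.
  apply: le_trans (lerD (cauchy_schwarz _ _) (cauchy_schwarz _ _)) _.
  rewrite -subr_ge0.
  have : 0 <= `|a| * `|B u| + `|b| * `|A u| by rewrite addr_ge0 ?mulr_ge0.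
  by congr (0 <= _); ring.
have [|[h k] [clhk /= phiE]] := riesz_pair phi_linear _ phi_le.
  exact: addr_ge0.
have [/= Mh Nk] := clMN _ clhk.
have hk u : inner (A u) (a - h) = inner (B u) (k - b).
  rewrite !innerBr; apply/eqP; rewrite subr_eq addrAC -subr_eq opprK.
  by rewrite [X in _ == X]addrC; apply/eqP/phiE.
have ha u : inner (A u) (a - h) = 0 by exact: (AB0 _ _ hk).
have kb u : inner (B u) (k - b) = 0 by rewrite -hk.
have -> : a = h by apply: orthocomplement2_inj Ma Mh _ => _ [u _ <-].
by have <- : k = b by apply: orthocomplement2_inj Nk Nb _ => _ [u _ <-].
Qed.

End Equivalences.

Theorem theorem6p6 (R : realType) (E H K : hilbertType R[i])
  (A : {linear E -> H}) (B : {linear E -> K})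
  (bndA : bounded_operator A) (bndB : bounded_operator B) :
  (singular_wrt B A <->
     range (adjoint A) `&` range (adjoint B) = [set (0 : E)]) /\
  (range (adjoint A) `&` range (adjoint B) = [set (0 : E)] <->
     singular_relation (pair_relation A B)).
Proof.
split; first exact: singular_wrt_ran_disjoint.
split; first exact: ran_disjoint_singular_relation.
exact: singular_relation_ran_disjoint.
Qed.
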